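(* There exists an absolute constant $C > 0$ such that the following holds. Let $G$ be a simple undirected graph on $n \ge 2$ vertices containing $t \ge 1$ triangles, and let $\Delta$ be the maximum, over all edges $e$ of $G$, of the number of triangles of $G$ containing $e$. Let $d > 0$, $\varepsilon \in (0,1)$ and $p \in (0,1]$ satisfy $$p^3 \ge C \,\frac{d\, \Delta \log n}{\varepsilon^2 t}.$$ Form a random subgraph $G_p$ of $G$ by keeping each edge of $G$ independently with probability $p$. Let $T_p$ be the number of triangles in $G_p$. Then with probability at least $1 - n^{3-d}$, $$|T_p - p^3 t| \le \varepsilon\, p^3 t,$$ that is, $p^{-3} T_p$ approximates $t$ within a multiplicative factor of $1 \pm \varepsilon$.
   Context: A triangle in a graph is a set of three pairwise adjacent vertices. $\log$ denotes the natural logarithm. *)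

(* Defs.v *)
From mathcomp Require Import all_boot all_order all_algebra.
From mathcomp Require Import all_classical all_reals all_analysis.
Set Implicit Arguments.
Unset Strict Implicit.
Unset Printing Implicit Defensive.
Import Order.TTheory GRing.Theory Num.Theory.
Local Open Scope ring_scope.

(* A simple graph on V is a symmetric irreflexive adjacency relation; an edge
   is the two-element set of its endpoints. *)
Definition edges (V : finType) (adj : rel V) : {set {set V}} :=
  [set [set xy.1; xy.2] | xy : V * V & adj xy.1 xy.2].

Definition edge_rel (V : finType) (F : {set {set V}}) : rel V :=
  [rel x y | [set x; y] \in F].

Definition triangles (V : finType) (adj : rel V) : {set {set V}} :=
  [set A : {set V} | (#|A| == 3)%N &
    [forall x in A, forall y in A, (x != y) ==> adj x y]].

Definition max_edge_triangles (V : finType) (adj : rel V) : nat :=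
  \max_(a in edges adj) #|[set A in triangles adj | a \subset A]|.

(* The law of the random subset F of E that contains each element of E
   independently with probability p, i.e. the product of Bernoulli(p) laws
   indexed by E: the probability of the event Q. *)
Definition Pr_subset (R : realType) (T : finType) (E : {set T}) (p : R)
    (Q : pred {set T}) : R :=
  \sum_(F in powerset E | Q F) \prod_(x in E) (if x \in F then p else 1 - p).

(* Main.v *)
Require Import Defs.
From mathcomp Require Import all_boot all_order all_algebra.
From mathcomp Require Import all_classical all_reals all_analysis.
From mathcomp Require Import ring lra.
Set Implicit Arguments.
Unset Strict Implicit.
Unset Printing Implicit Defensive.
Import Order.TTheory GRing.Theory Num.Theory.
Local Open Scope ring_scope.

(** Call two triangles in conflict if they share an edge.  A triangle conflicts
    with fewer than [3 * Delta] others, so greedy colouring splits the triangles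
    into [m = 3 * Delta] classes of pairwise edge-disjoint, hence independent,
    triangles.  The classes need not be balanced: by convexity, the exponential
    of the average over the classes is at most the average of the exponentials,
    which gives, for every [v],
      [E exp ((v * T_p - (exp v - 1) * p^3 * t) / m) <= 1].
    Markov's inequality at [v = eps/4] and [v = - eps/4], together with
    [exp v <= 1 + v + 2 v^2], bounds the failure probability by
    [2 exp (- eps^2 p^3 t / (24 Delta))], which is at most [2 n^-d] for [C = 24]. *)

(** * Weights of random subsets *)

Lemma prodD_powerset (R : comPzRingType) (T : finType) (E : {set T})
    (f g : T -> R) :
  \prod_(x in E) (f x + g x) =
  \sum_(F in powerset E) \prod_(x in E) (if x \in F then f x else g x).
Proof.
(* Factors outside [E] are padded to [0 + 1], so in the expansion over all subsets of [T] those not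
   contained in [E] vanish. *)
rewrite big_mkcond /= (eq_bigr (fun x => (if x \in E then f x else 0) +
  (if x \in E then g x else 1))); last by move=> x _; case: ifP; rewrite ?add0r.
rewrite bigA_distr (bigID (mem (powerset E))) /= [X in _ + X]big1 ?addr0.
  apply: eq_big => [F|F]; first by rewrite powersetE.
  rewrite powersetE => /fintype.subsetP FE.
  rewrite [RHS]big_mkcond; apply: eq_bigr => x _.
  by case: ifPn => [/FE ->|]; case: (x \in E).
move=> F; rewrite powersetE => /subsetPn[x xF xE].
by rewrite (bigD1 x) //= xF (negbTE xE) mul0r.
Qed.

Definition bernoulli_weight (R : realType) (T : finType) (E : {set T}) (p : R)
    (F : {set T}) : R :=
  \prod_(x in E) (if x \in F then p else 1 - p).

Lemma bernoulli_weight_ge0 (R : realType) (T : finType) (E F : {set T})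
    (p : R) :
  0 <= p <= 1 -> 0 <= bernoulli_weight E p F.
Proof.
move=> /andP[p0 p1]; apply: prodr_ge0 => x _.
by case: ifP; rewrite ?subr_ge0.
Qed.

(** Replacing the absence weight [1 - p] by 0 on [S] encodes the event [S \subset F] in the product.
    The sum then factorises: [p] for each point of [S], and [p + (1 - p) = 1] for each other point
    of [E]. *)
Lemma bernoulli_superset (R : realType) (T : finType) (E S : {set T}) (p : R) :
  S \subset E ->
  \sum_(F in powerset E | S \subset F) bernoulli_weight E p F = p ^+ #|S|.
Proof.
move=> SE; rewrite big_mkcondr /=.
rewrite (eq_bigr (fun F : {set T} => \prod_(x in E)
  (if x \in F then p else (1 - p) * (x \notin S)%:R))).
  rewrite -prodD_powerset.
  rewrite (big_setID S) /= (finset.setIidPr SE) [X in _ * X]big1 ?mulr1.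
    rewrite -prodr_const; apply: eq_bigr => x xS.
    by rewrite xS mulr0 addr0.
  by move=> x; rewrite inE => /andP[-> _]; rewrite mulr1 subrKC.
move=> F _; case: ifPn => [SF|/subsetPn[x xS xF]].
  apply: eq_bigr => x _; case: ifPn => // xF.
  by rewrite (contra (fintype.subsetP SF x)) ?mulr1.
by rewrite (bigD1 x) ?(fintype.subsetP SE) //= (negbTE xF) xS mulr0 mul0r.
Qed.

Lemma bernoulli_weight_sum (R : realType) (T : finType) (E : {set T}) (p : R) :
  \sum_(F in powerset E) bernoulli_weight E p F = 1.
Proof.
rewrite -(expr0 p) -(cards0 T) -(bernoulli_superset p (finset.sub0set E)).
by apply: eq_bigl => F; rewrite finset.sub0set andbT.
Qed.

(** Double counting: each [x] lies in at most one of the [e i]. *)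
Lemma card_bigcup_disjoint (T I : finType) (e : I -> {set T}) (B : {set I}) :
  {in B &, forall i j, i != j -> [disjoint e i & e j]} ->
  #|\bigcup_(i in B) e i| = (\sum_(i in B) #|e i|)%N.
Proof.
move=> dis; have E (A : {set T}) : #|A| = (\sum_x (x \in A))%N.
  by rewrite -sum1_card big_mkcond.
rewrite E; under [RHS]eq_bigr do rewrite E; rewrite exchange_big /=.
apply: eq_bigr => x _; case: bigcupP => [[i iB xi]|nx].
  rewrite (bigD1 i) //= xi big1 // => j /andP[jB ji].
  by rewrite (disjointFl (dis _ _ jB iB ji) xi).
rewrite big1 // => i iB; apply/eqP; rewrite eqb0; apply: contra_notN nx => xi.
by exists i.
Qed.

Lemma expR_avg_le (R : realType) (k : nat) (a : 'I_k -> R) : (0 < k)%N ->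
  expR ((\sum_j a j) / k%:R) <= (\sum_j expR (a j)) / k%:R.
Proof.
(* Sum [1 + (a j - m) <= expR (a j - m)] over [j], where [m] is the mean. *)
move=> k0; set m := _ / _; have k0' : 0 < k%:R :> R by rewrite ltr0n.
rewrite ler_pdivlMr // -ler_pdivlMl ?expR_gt0 // -expRN big_distrr /=.
apply: (@le_trans _ _ (\sum_j (1 + (a j - m)))); last first.
  apply: ler_sum => j _; rewrite -expRD [- m + _]addrC; exact: expR_ge1Dx.
rewrite big_split /= sumrB !sumr_const card_ord -[X in _ - X]mulr_natr.
by rewrite divfK ?subrr ?addr0 // gt_eqF.
Qed.

(** * Greedy colouring *)

Lemma greedy_coloring (T : finType) (r : rel T) (k : nat) :
  symmetric r ->
  (forall x, (#|[set y | (y != x) && r x y]| < k)%N) ->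
  exists c : T -> 'I_k, forall x y, x != y -> r x y -> c x != c y.
Proof.
move=> rsym deg.
suff H (s : seq T) : exists c : T -> 'I_k,
    {in s &, forall x y, x != y -> r x y -> c x != c y}.
  have [c hc] := H (enum T); exists c => x y.
  by apply: hc; rewrite mem_enum.
elim: s => [|x s [c hc]].
  (* A point of [T] forces [0 < k] through [deg]; if [T] is empty, [k] may be 0 and the colouring is
     the empty function. *)
  have [x _|T0] := pickP (mem T).
    by exists (fun _ => Ordinal (leq_ltn_trans (leq0n _) (deg x))).
  have T0' (x : T) : False by have := T0 x.
  by exists (fun x => False_rect _ (T0' x)).
set N := [set y | (y != x) && r x y].
have [a aN] : exists a : 'I_k, a \notin c @: N.
  apply/existsP; rewrite -negb_forall; apply/negP => /forallP h.
  have : (k <= #|c @: N|)%N.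
    rewrite -[X in (X <= _)%N]card_ord -cardsT; apply: subset_leq_card.
    by apply/fintype.subsetP => i _; apply: h.
  by rewrite leqNgt (leq_ltn_trans (leq_imset_card c N) (deg x)).
have aN' y : y != x -> r x y -> a != c y.
  move=> yx rxy; apply: contraNneq aN => ->.
  by apply: imset_f; rewrite inE yx.
(* If [x] already occurs in [s] it is recoloured, which is harmless since [a] avoids the colours of
   all its neighbours. *)
exists (fun y => if y == x then a else c y) => y z.
rewrite !inE; have [->|yx] := eqVneq y x; have [->|zx] := eqVneq z x => //=.
- by move=> _ _ _; apply: aN'.
- by move=> _ _ _; rewrite rsym eq_sym; apply: aN'.
- exact: hc.
Qed.

(** * Exponential moments and tails of counts *)

Lemma bernoulli_mgf_disjoint (R : realType) (T I : finType) (E : {set T})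
    (e : I -> {set T}) (J : {set I}) (k : nat) (p c : R) :
  {in J, forall i, e i \subset E /\ #|e i| = k} ->
  {in J &, forall i j, i != j -> [disjoint e i & e j]} ->
  \sum_(F in powerset E)
     bernoulli_weight E p F * \prod_(i in J) (c * (e i \subset F)%:R + 1) =
  (c * p ^+ k + 1) ^+ #|J|.
Proof.
(* Expanding the product over [B \subset J] leaves the events
   [\bigcup_(i in B) e i \subset F], whose union has [k * #|B|] elements. *)
move=> he dis.
have restrict (B : {set I}) (h : I -> R) : B \subset J ->
    \prod_(i in J) (if i \in B then h i else 1) = \prod_(i in B) h i.
  move=> BJ; rewrite -big_mkcondr /=; apply: eq_bigl => i.
  by rewrite andb_idl // => /(fintype.subsetP BJ).
under eq_bigr do rewrite prodD_powerset big_distrr.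
rewrite exchange_big /= -prodr_const prodD_powerset; apply: eq_bigr => B.
rewrite powersetE => BJ; rewrite restrict //.
under eq_bigr do rewrite restrict //.
have -> : \prod_(i in B) (c * p ^+ k) = c ^+ #|B| * p ^+ #|\bigcup_(i in B) e i|.
  rewrite prodr_const exprMn -exprM card_bigcup_disjoint; last first.
    by move=> i j iB jB; apply: dis; apply: (fintype.subsetP BJ).
  rewrite (eq_bigr (fun=> k)) ?sum_nat_const 1?mulnC //.
  by move=> i /(fintype.subsetP BJ) /he [].
rewrite -(@bernoulli_superset _ _ E); last first.
  by apply/finset.bigcupsP => i /(fintype.subsetP BJ) /he [].
rewrite big_distrr [RHS]big_mkcondr /=; apply: eq_bigr => F _.
rewrite big_split prodr_const /=.
case: ifPn => [/finset.bigcupsP BF|].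
  by rewrite big1 ?mulr1 1?mulrC // => i /BF ->.
move=> h; suff -> : \prod_(i in B) (e i \subset F)%:R = 0 :> R by rewrite !mulr0.
apply/eqP; apply: contraNT h => /prodf_neq0 h.
apply/finset.bigcupsP => i iB; have := h i iB.
by case: (e i \subset F); rewrite // eqxx.
Qed.

Lemma bernoulli_count_mgf_le1 (R : realType) (T I : finType) (E : {set T})
    (e : I -> {set T}) (J : {set I}) (k m : nat) (c : I -> 'I_m) (p v : R) :
  0 <= p <= 1 -> (0 < m)%N ->
  {in J, forall i, e i \subset E /\ #|e i| = k} ->
  {in J &, forall i j, i != j -> c i = c j -> [disjoint e i & e j]} ->
  \sum_(F in powerset E) bernoulli_weight E p F *
    expR ((v * #|[set i in J | e i \subset F]|%:R
            - (expR v - 1) * p ^+ k * #|J|%:R) / m%:R) <= 1.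
Proof.
move=> p01 m0 he dis.
have m0' : 0 < m%:R :> R by rewrite ltr0n.
pose Jc j := [set i in J | c i == j].
pose a (F : {set T}) j :=
  \sum_(i in Jc j) (v * (e i \subset F)%:R - (expR v - 1) * p ^+ k).
have sum_a (F : {set T}) : v * #|[set i in J | e i \subset F]|%:R
    - (expR v - 1) * p ^+ k * #|J|%:R = \sum_j a F j.
  rewrite -sum1dep_card natr_sum big_distrr /= big_mkcondr /=.
  rewrite [_ * #|J|%:R]mulr_natr -[_ *+ #|J|]sumr_const -sumrB.
  rewrite (partition_big c xpredT) //=; apply: eq_bigr => j _.
  apply: eq_big => [i|i _]; first by rewrite inE.
  by case: ifP; rewrite ?mulr0.
apply: (@le_trans _ _ (\sum_(F in powerset E) bernoulli_weight E p F *
   ((\sum_j expR (a F j)) / m%:R))).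
  apply: ler_sum => F _; rewrite ler_wpM2l ?bernoulli_weight_ge0 //.
  by rewrite sum_a expR_avg_le.
under eq_bigr do rewrite mulrA big_distrr /=.
rewrite -big_distrl /= exchange_big /= ler_pdivrMr // mul1r.
apply: (@le_trans _ _ (\sum_(j < m) 1)); last by rewrite sumr_const card_ord.
apply: ler_sum => j _.
(* For [b] equal to 0 or 1, [expR (v * b) = (expR v - 1) * b + 1], so the product formula gives the
   exact exponential moment of one class. *)
have mgf := @bernoulli_mgf_disjoint R T I E e (Jc j) k p (expR v - 1).
apply: (@le_trans _ _ (((expR v - 1) * p ^+ k + 1) ^+ #|Jc j| *
   expR (- ((expR v - 1) * p ^+ k) * #|Jc j|%:R))).
  rewrite -mgf.
  - rewrite big_distrl /=; apply: ler_sum => F _; rewrite -mulrA.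
    rewrite ler_wpM2l ?bernoulli_weight_ge0 // expRM_natr -prodr_const.
    rewrite -big_split expR_sum /=.
    rewrite le_eqVlt; apply/predU1l; apply: eq_bigr => i _.
    rewrite expRD; congr (_ * _); case: (e i \subset F).
      by rewrite !mulr1 subrK.
    by rewrite !mulr0 expR0 add0r.
  - by move=> i; rewrite inE => /andP[/he].
  - move=> i i'; rewrite !inE => /andP[iJ /eqP ci] /andP[i'J /eqP ci'] ii'.
    by apply: dis; rewrite // ci ci'.
(* With [q = (expR v - 1) * p ^+ k], the base is [(q + 1) / expR q]. It is at most 1, and it is
   nonnegative even for [v < 0] because [expR v - 1 > -1] and [p ^+ k <= 1]. *)
rewrite expRM_natr -exprMn expRN; apply: exprn_ile1.
  rewrite mulr_ge0 ?invr_ge0 ?expR_ge0 //.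
  have /andP[p0 p1] := p01.
  have : p ^+ k <= 1 by apply: exprn_ile1.
  have : 0 <= p ^+ k by apply: exprn_ge0.
  by have := expR_gt0 v; nra.
by rewrite ler_pdivrMr ?expR_gt0 // mul1r addrC expR_ge1Dx.
Qed.

Lemma expR_le1Dx2 (R : realType) (x : R) :
  x <= 1/2 -> expR x <= 1 + x + 2 * x ^+ 2.
Proof.
(* [exp x <= 1 / (1 - x) <= 1 + x + 2 x^2]. *)
move=> xh; have := expR_ge1Dx (- x); rewrite expRN => h.
have x1 : 0 < 1 - x by lra.
have : expR x <= (1 - x)^-1.
  by rewrite -[leLHS]invrK lef_pV2 ?posrE ?invr_gt0 ?expR_gt0.
move=> /le_trans; apply; rewrite -div1r ler_pdivrMr //.
have := sqr_ge0 x; nra.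
Qed.

Lemma bernoulli_count_tail (R : realType) (T I : finType) (E : {set T})
    (e : I -> {set T}) (J : {set I}) (k m : nat) (c : I -> 'I_m)
    (p eps : R) :
  0 <= p <= 1 -> 0 < eps < 1 -> (0 < m)%N ->
  {in J, forall i, e i \subset E /\ #|e i| = k} ->
  {in J &, forall i j, i != j -> c i = c j -> [disjoint e i & e j]} ->
  1 - 2 * expR (- (eps ^+ 2 / 8 * (p ^+ k * #|J|%:R) / m%:R)) <=
  Pr_subset E p (fun F => `| #|[set i in J | e i \subset F]|%:R
                             - p ^+ k * #|J|%:R | <= eps * p ^+ k * #|J|%:R).
Proof.
move=> p01 /andP[eps0 eps1] m0 he dis.
have m0' : 0 < m%:R :> R by rewrite ltr0n.
have [p0 _] := andP p01.
have mgf v := bernoulli_count_mgf_le1 v p01 m0 he dis.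
set Q := fun F : {set T} => _.
rewrite lerBlDr -[leLHS](bernoulli_weight_sum E p) (bigID Q) /= lerD2l.
set mu := p ^+ k * #|J|%:R.
have mu0 : 0 <= mu by rewrite mulr_ge0 ?exprn_ge0.
set M := eps ^+ 2 / 8 * mu / m%:R.
pose Z v (F : {set T}) : R := (v * #|[set i in J | e i \subset F]|%:R
  - (expR v - 1) * p ^+ k * #|J|%:R) / m%:R.
(* At [v = eps/4] or [v = - eps/4], a deviation beyond [eps * mu] gains [eps^2/4 * mu]; the
   second-order loss [2 * v^2 * mu] is [eps^2/8 * mu], which leaves [M * m]. *)
have Zge v (F : {set T}) : v <= 1/2 -> v ^+ 2 = eps ^+ 2 / 16 ->
    eps ^+ 2 / 4 * mu <= v * (#|[set i in J | e i \subset F]|%:R - mu) ->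
    M <= Z v F.
  move=> vh v2 hv; rewrite ler_pM2r ?invr_gt0 // -[_ * p ^+ k * _]mulrA -/mu.
  have := expR_le1Dx2 vh; rewrite v2 => hexp.
  have : (expR v - 1) * mu <= (v + eps ^+ 2 / 8) * mu.
    by apply: ler_wpM2r => //; lra.
  lra.
(* The positive [v] handles the upper tail and the negative [v] the lower one; the other exponential
   is dropped as nonnegative. *)
have bad (F : {set T}) : ~~ Q F ->
    expR M <= expR (Z (eps / 4) F) + expR (Z (- (eps / 4)) F).
  rewrite -ltNge -mulrA -/mu ltr_normr => /orP[] hN.
  - apply: ler_wpDr; rewrite ?expR_ge0 // ler_expR; apply: Zge; first by lra.
      by field.
    by nra.
  - apply: ler_wpDl; rewrite ?expR_ge0 // ler_expR; apply: Zge; first by lra.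
      by field.
    by nra.
apply: (@le_trans _ _ (\sum_(F in powerset E) bernoulli_weight E p F *
    (expR (- M) * (expR (Z (eps / 4) F) + expR (Z (- (eps / 4)) F))))).
  rewrite big_mkcondr /=; apply: ler_sum => F _.
  have w0 := bernoulli_weight_ge0 E F p01.
  case: ifPn => [/bad hb|_]; last first.
    by rewrite !mulr_ge0 ?addr_ge0 ?expR_ge0.
  rewrite -[leLHS]mulr1 ler_wpM2l // expRN.
  by rewrite ler_pdivlMl ?expR_gt0 // mulr1.
under eq_bigr do rewrite mulrCA mulrDr.
rewrite -big_distrr big_split /= mulrC ler_pM2r ?expR_gt0 //.
by apply: lerD; apply: mgf.
Qed.

(** * Triangles as sets of edges, and their conflicts *)

Section Triangles.
Variables (V : finType) (adj : rel V).
Hypotheses (adj_sym : symmetric adj) (adj_irr : irreflexive adj).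

Definition pairs_in (A : {set V}) : {set {set V}} :=
  [set B : {set V} | B \subset A & #|B| == 2].

Lemma pairs_inP (A B : {set V}) :
  reflect (exists x y, [/\ x \in A, y \in A, x != y & B = [set x; y]])
          (B \in pairs_in A).
Proof.
rewrite inE; apply: (iffP andP) => [[BA /cards2P[x [y [xy eB]]]]|].
  by exists x, y; split; rewrite // (fintype.subsetP BA) // eB !inE eqxx ?orbT.
move=> [x [y [xA yA xy ->]]]; rewrite cards2 xy; split => //.
by apply/fintype.subsetP => z; rewrite !inE => /orP[] /eqP ->.
Qed.

(** Irreflexivity keeps singletons out of [edges adj]; symmetry makes the order of the endpoints
    irrelevant. *)
Lemma mem_edges (x y : V) : ([set x; y] \in edges adj) = adj x y.
Proof.
apply/imsetP/idP => [[[u v] /= uv exy]|xy]; last first.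
  by exists (x, y); rewrite ?inE.
rewrite inE /= in uv.
have uv' : u != v by apply: contraTneq uv => ->; rewrite adj_irr.
have xy : x != y.
  have := congr1 (fun A : {set V} => #|A|) exy.
  by rewrite !cards2 uv' => /eqP; case: (x != y).
have : x \in [set u; v] by rewrite -exy !inE eqxx.
have : y \in [set u; v] by rewrite -exy !inE eqxx orbT.
rewrite !inE => /orP[] /eqP ey /orP[] /eqP ex; move: xy uv; subst x y.
- by rewrite eqxx.
- by rewrite adj_sym.
- by [].
- by rewrite eqxx.
Qed.

Lemma mem_triangles_edge_rel (F : {set {set V}}) (A : {set V}) :
  (A \in triangles (edge_rel F)) = (#|A| == 3) && (pairs_in A \subset F).
Proof.
rewrite inE; congr (_ && _); apply/idP/fintype.subsetP.
  move=> /forall_inP h B /pairs_inP[x [y [xA yA xy ->]]].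
  by have /forall_inP/(_ y yA)/implyP/(_ xy) := h x xA.
move=> h; apply/forall_inP => x xA; apply/forall_inP => y yA.
by apply/implyP => xy; apply: h; apply/pairs_inP; exists x, y.
Qed.

Lemma mem_triangles (A : {set V}) :
  (A \in triangles adj) = (#|A| == 3) && (pairs_in A \subset edges adj).
Proof.
rewrite -mem_triangles_edge_rel !inE; congr (_ && _).
apply: eq_forallb => x; congr (_ ==> _); apply: eq_forallb => y.
by rewrite /edge_rel /= mem_edges.
Qed.

(** This puts the triangle count of the random subgraph into the form treated by
    [bernoulli_count_tail]. *)
Lemma triangles_subgraph (F : {set {set V}}) : F \subset edges adj ->
  triangles (edge_rel F) = [set A in triangles adj | pairs_in A \subset F].
Proof.
move=> FE; apply/setP => A; rewrite mem_triangles_edge_rel [RHS]inE mem_triangles.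
rewrite -andbA; congr (_ && _); apply/idP/andP => [AF|[]//].
by split; rewrite // (fintype.subset_trans AF).
Qed.

Lemma card_pairs_in (A : {set V}) : A \in triangles adj -> #|pairs_in A| = 3%N.
Proof. by rewrite mem_triangles => /andP[/eqP A3 _]; rewrite cards_draws A3. Qed.

Lemma card_triangles_at_edge (a : {set V}) : a \in edges adj ->
  (#|[set A in triangles adj | a \subset A]| <= max_edge_triangles adj)%N.
Proof. by move=> aE; apply: (leq_bigmax_cond a). Qed.

Lemma max_edge_triangles_gt0 (A : {set V}) :
  A \in triangles adj -> (0 < max_edge_triangles adj)%N.
Proof.
move=> At; have : (0 < #|pairs_in A|)%N by rewrite card_pairs_in.
case/card_gt0P => a aA.
have aE : a \in edges adj.
  by have := At; rewrite mem_triangles => /andP[_ /fintype.subsetP]; apply.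
apply: leq_trans (card_triangles_at_edge aE); apply/card_gt0P; exists A.
by rewrite inE At; move: aA; rewrite inE => /andP[].
Qed.

(** Every conflict of [A] passes through one of its three edges, each lying in at most
    [max_edge_triangles adj] triangles. *)
Lemma triangle_coloring : (0 < max_edge_triangles adj)%N ->
  exists c : {set V} -> 'I_(3 * max_edge_triangles adj),
  {in triangles adj &, forall A B, A != B -> c A = c B ->
     [disjoint pairs_in A & pairs_in B]}.
Proof.
move=> D0.
pose r (A B : {set V}) := [&& A \in triangles adj, B \in triangles adj &
  ~~ [disjoint pairs_in A & pairs_in B]].
have rsym : symmetric r.
  by move=> A B; rewrite /r disjoint_sym andbCA.
have [c hc] : exists c : {set V} -> 'I_(3 * max_edge_triangles adj),
    forall A B, A != B -> r A B -> c A != c B.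
  apply: greedy_coloring => // A.
  have [At|At] := boolP (A \in triangles adj); last first.
    rewrite (_ : [set B | _] = finset.set0) ?cards0 ?muln_gt0 //.
    by apply/setP => B; rewrite !inE /r (negbTE At) andbF.
  pose U := \bigcup_(a in pairs_in A) [set B in triangles adj | a \subset B].
  apply: (@leq_trans #|U|).
    (* [U] also contains [A], which is not its own neighbour; this gives the strict inequality that
       greedy colouring requires. *)
    apply: proper_card; apply/properP; split.
      apply/fintype.subsetP => B; rewrite inE => /and4P[_ _ Bt].
      case/pred0Pn => a /= /andP[aA aB]; apply/finset.bigcupP; exists a => //.
      by rewrite inE Bt; move: aB; rewrite inE => /andP[].
    exists A; last by rewrite inE eqxx.
    have : (0 < #|pairs_in A|)%N by rewrite card_pairs_in.
    case/card_gt0P => a aA; apply/finset.bigcupP; exists a => //.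
    by rewrite inE At; move: aA; rewrite inE => /andP[].
  rewrite -(card_pairs_in At) -sum_nat_const.
  apply: (@leq_trans (\sum_(a in pairs_in A)
    #|[set B in triangles adj | a \subset B]|)).
    apply: (big_ind2 (fun (X : {set {set V}}) n => #|X| <= n)%N) => //.
      by rewrite cards0.
    move=> X x Y y hX hY; apply: leq_trans (leq_add hX hY).
    by rewrite cardsU leq_subr.
  apply: leq_sum => a aA; apply: card_triangles_at_edge.
  by have := At; rewrite mem_triangles => /andP[_ /fintype.subsetP]; apply.
exists c => A B At Bt AB cAB; apply: contraT => dAB.
by have := hc A B AB; rewrite /r At Bt dAB cAB eqxx => /(_ isT).
Qed.

End Triangles.

Theorem theorem4 (R : realType) :
  exists C : R, 0 < C /\
  forall (V : finType) (adj : rel V) (n t Delta : nat) (d eps p : R),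
    symmetric adj -> irreflexive adj ->
    n = #|V| -> t = #|triangles adj| -> Delta = max_edge_triangles adj ->
    (2 <= n)%N -> (1 <= t)%N ->
    0 < d -> 0 < eps < 1 -> 0 < p <= 1 ->
    C * ((d * Delta%:R * ln n%:R) / (eps ^+ 2 * t%:R)) <= p ^+ 3 ->
    1 - n%:R `^ (3 - d) <=
      Pr_subset (edges adj) p
        (fun F => `| #|triangles (edge_rel F)|%:R - p ^+ 3 * t%:R |
                    <= eps * p ^+ 3 * t%:R).
Proof.
(* [24 = 8 * 3]: 8 from the tail exponent, 3 from the [3 * Delta] colours. *)
exists 24; split; first by lra.
move=> V adj n t Delta d eps p adj_sym adj_irr _ tE DeltaE n2 t1 d0 eps01.
move=> /andP[p0 p1] hp.
have p01 : 0 <= p <= 1 by rewrite (ltW p0).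
have Delta0 : (0 < Delta)%N.
  move: t1; rewrite tE DeltaE => /card_gt0P[A].
  exact: max_edge_triangles_gt0.
have [c hc] : exists c : {set V} -> 'I_(3 * Delta),
    {in triangles adj &, forall A B, A != B -> c A = c B ->
      [disjoint pairs_in A & pairs_in B]}.
  by move: Delta0; rewrite DeltaE; apply: triangle_coloring.
have he : {in triangles adj, forall A,
    pairs_in A \subset edges adj /\ #|pairs_in A| = 3%N}.
  move=> A At; split; last exact: card_pairs_in At.
  by move: At; rewrite mem_triangles // => /andP[].
have m0 : (0 < 3 * Delta)%N by rewrite muln_gt0.
have := bernoulli_count_tail p01 eps01 m0 he hc.
rewrite -tE => tail.
have -> : Pr_subset (edges adj) p
    (fun F => `| #|triangles (edge_rel F)|%:R - p ^+ 3 * t%:R |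
                <= eps * p ^+ 3 * t%:R) =
  Pr_subset (edges adj) p
    (fun F => `| #|[set A in triangles adj | pairs_in A \subset F]|%:R
                 - p ^+ 3 * t%:R | <= eps * p ^+ 3 * t%:R).
  apply: eq_bigl => F; rewrite powersetE.
  (* The two events need to agree only on subsets of [edges adj], the range of the sum. *)
  by case: (boolP (F \subset _)) => // FE; rewrite (triangles_subgraph adj_sym).
apply: le_trans tail; rewrite lerD2l lerN2.
have n0 : 0 < n%:R :> R by rewrite ltr0n; apply: leq_trans n2.
have Delta0' : 0 < Delta%:R :> R by rewrite ltr0n.
have t0 : 0 < t%:R :> R by rewrite ltr0n.
have [eps0 _] := andP eps01.
apply: (@le_trans _ _ (2 * expR (- (d * ln n%:R)))).
  rewrite ler_pM2l // ler_expR lerN2 natrM ler_pdivlMr ?mulr_gt0 //.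
  move: hp; rewrite mulrA ler_pdivrMr ?mulr_gt0 ?exprn_gt0 //; lra.
rewrite powRB; last by apply/implyP => _; rewrite gt_eqF.
rewrite powR_mulrn ?ler0n // expRN.
have -> : n%:R `^ d = expR (d * ln n%:R) by rewrite /powR gt_eqF.
(* Cancelling [n^-d] leaves [2 <= n^3], so the factor 2 from the two tails is absorbed. *)
rewrite ler_pM2r ?invr_gt0 ?expR_gt0 // -natrX ler_nat.
apply: (leq_trans n2).
rewrite -[leqLHS]expn1; apply: leq_pexp2l => //; exact: ltnW n2.
Qed.
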